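(* Let $\mathbf{U}^0,\mathbf{U}^1,\dots,\mathbf{U}^{N_t}\in\mathbb{R}^N$ be a solution of the LLF-MP scheme $$(\mathbb{I}-\sigma\mathbb{D}_2)\,\delta_t\mathbf{U}^n+\mathbb{D}(\mathbf{U}^n)\,\widehat{\mathbf{U}}^{n}=0,\qquad n\ge 1,$$ where the first level $\mathbf{U}^1$ satisfies $$(\mathbb{I}-\sigma\mathbb{D}_2)\,\delta_t^+\mathbf{U}^0+\mathbb{D}\big(\mathbf{U}^{\frac12}\big)\mathbf{U}^{\frac12}=0 .$$ Then the discrete momentum conservation law holds: $$\mathcal{I}_{2_h}^{\,n}=\mathcal{I}_{2_h}^{\,0}\quad\text{for all } n\ge 0,\qquad\text{where }\ \mathcal{I}_{2_h}^{\,n}=\|\mathbf{U}^n\|_h^2+\sigma|\mathbf{U}^n|_h^2 .$$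
   Context: Constants: $a,\sigma,\gamma>0$. $N$ is a positive even integer, $L=x_R-x_L>0$, $h=L/N$, $x_j=x_L+jh$ for $0\le j\le N-1$, $\mu=2\pi/L$. Time step $\tau=T/N_t$ with $N_t$ a positive integer; time levels are $0\le n\le N_t$. Grid functions are vectors $\mathbf{U}=(U_0,\dots,U_{N-1})$, with discrete inner product $(\mathbf{U},\mathbf{V})_h=h\sum_{j=0}^{N-1}U_j\overline{V}_j$ and norm $\|\mathbf{U}\|_h=\sqrt{(\mathbf{U},\mathbf{U})_h}$. Fourier differentiation matrices: $g_j(x)=\frac1N\sum_{k=-N/2}^{N/2}\frac1{c_k}e^{ik\mu(x-x_j)}$ with $c_k=1$ for $|k|\ne N/2$ and $c_{\pm N/2}=2$; $(\mathbb{D}_k)_{jl}=\frac{d^k g_l}{dx^k}(x_j)$, $0\le j,l\le N-1$. $\mathbb{I}$ is the identity matrix. ($\mathbb{D}_1$ is real antisymmetric, $\mathbb{D}_2$ is real symmetric negative semi-definite.) Semi-norm: $|\mathbf{U}|_h=\sqrt{(-\mathbb{D}_2\mathbf{U},\mathbf{U})_h}$. For a vector $\mathbf{U}$, $\mathbb{D}(\mathbf{U})=a\mathbb{D}_1+\frac{\gamma}{3}\big(\mathrm{diag}(\mathbf{U})\mathbb{D}_1+\mathbb{D}_1\mathrm{diag}(\mathbf{U})\big)$. Time notation: $\delta_t\mathbf{U}^n=\frac{\mathbf{U}^{n+1}-\mathbf{U}^{n-1}}{2\tau}$, $\widehat{\mathbf{U}}^{n}=\frac{\mathbf{U}^{n+1}+\mathbf{U}^{n-1}}{2}$,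 $\delta_t^+\mathbf{U}^0=\frac{\mathbf{U}^{1}-\mathbf{U}^0}{\tau}$, $\mathbf{U}^{\frac12}=\frac{\mathbf{U}^{1}+\mathbf{U}^0}{2}$. These discretize the periodic regularized long-wave equation $u_t+au_x-\sigma u_{xxt}+(\tfrac{\gamma}{2}u^2)_x=0$ (real-valued $u$) on $[x_L,x_R]$. *)

(* Defs.v *)
From HB Require Import structures.
From mathcomp Require Import all_boot all_order all_algebra.
From mathcomp Require Import complex.
From mathcomp Require Import all_classical all_reals all_analysis.

Set Implicit Arguments.
Unset Strict Implicit.
Unset Printing Implicit Defensive.

Import Order.TTheory GRing.Theory Num.Theory.
Import numFieldNormedType.Exports.

Local Open Scope ring_scope.
Local Open Scope complex_scope.

Section FourierPseudospectral.
Variable R : realType.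

Definition expi (theta : R) : R[i] := cos theta +i* sin theta.

(* The k-th derivative of a complex-valued function of a real variable, taken
   componentwise since R[i] carries no normed R-module structure. *)
Definition cderiven (k : nat) (f : R -> R[i]) (x : R) : R[i] :=
  derive1n k (fun t => complex.Re (f t)) x +i* derive1n k (fun t => complex.Im (f t)) x.

Variables (xL xR : R) (N : nat).

Definition mesh : R := (xR - xL) / N%:R.
Definition node (j : 'I_N) : R := xL + j%:R * mesh.
Definition wavenumber : R := 2 * pi / (xR - xL).

(* c_k = 2 exactly when |k| = N / 2. *)
Definition cweight (k : int) : R[i] := if `|k|%N == N./2 then 2 else 1.

(* The frequency k ranging over -N/2 <= k <= N/2 is m - N/2 with 0 <= m <= N
   (N is even). *)
Definition cardinal_fun (j : 'I_N) (x : R) : R[i] :=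
  N%:R^-1 * \sum_(0 <= m < N.+1)
    let k : int := m%:Z - (N./2)%:Z in
    (cweight k)^-1 * expi (k%:~R * wavenumber * (x - node j)).

Definition fourier_diffmx (k : nat) : 'M[R[i]]_N :=
  \matrix_(j, l) cderiven k (cardinal_fun l) (node j).

Definition inner_h (U V : 'cV[R[i]]_N) : R[i] :=
  mesh%:C * \sum_j U j 0 * (V j 0)^*%R.

(* As usual for norms over R[i], the values are nonnegative reals of R[i], on
   which sqrtC is the ordinary square root. *)
Definition norm_h (U : 'cV[R[i]]_N) : R[i] := sqrtC (inner_h U U).

Definition seminorm_h (U : 'cV[R[i]]_N) : R[i] :=
  sqrtC (inner_h (- fourier_diffmx 2 *m U) U).

Definition Dop (a gamma : R) (U : 'cV[R[i]]_N) : 'M[R[i]]_N :=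
  a%:C *: fourier_diffmx 1 +
  (gamma / 3)%:C *: (diag_mx U^T *m fourier_diffmx 1 +
                     fourier_diffmx 1 *m diag_mx U^T).

Definition momentum_h (sigma : R) (U : 'cV[R[i]]_N) : R[i] :=
  norm_h U ^+ 2 + sigma%:C * seminorm_h U ^+ 2.

End FourierPseudospectral.

Section TimeOperators.
Variables (R : realType) (N : nat) (tau : R) (U : nat -> 'cV[R[i]]_N).

(* delta_t and hat_avg are only meaningful for n >= 1. *)
Definition delta_t (n : nat) : 'cV[R[i]]_N :=
  ((2 * tau)^-1)%:C *: (U n.+1 - U n.-1).
Definition hat_avg (n : nat) : 'cV[R[i]]_N :=
  2^-1 *: (U n.+1 + U n.-1).
Definition delta_t_plus0 : 'cV[R[i]]_N := (tau^-1)%:C *: (U 1%N - U 0%N).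
Definition half_level : 'cV[R[i]]_N := 2^-1 *: (U 1%N + U 0%N).

End TimeOperators.

(* Main.v *)
Require Import Defs.
From mathcomp Require Import all_boot all_order all_algebra.
From mathcomp Require Import complex.
From mathcomp Require Import all_classical all_reals all_analysis.
From mathcomp Require Import ring.

(** Every step of the scheme, the starting one included, has the shape
    M (c (V - W)) + K (V + W) / 2 = 0, where V and W are the newer and older
    levels, M = I - sigma D_2 and K = D(X) for some grid vector X. If M is
    symmetric and K antisymmetric, pairing this equation with V + W kills the
    K term, and the cross terms of the M term cancel, leaving
    V^T M V = W^T M W ([midpoint_conservation]). On real vectors V^T M V is the
    momentum up to the factor h ([momentum_quadratic_form]), and D(X) is
    antisymmetric for every X ([Dop_antisym]). A step of the scheme proper relates
    levels two apart, and the starting step ties level 1 to level 0.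

    What remains is the parity of the differentiation matrices,
    D_k^T = (-1)^k D_k ([fourier_diffmx_tr]). Differentiating the trigonometric
    sum termwise, the (j, l) entry of D_k is
    (1/N) sum_q (1/c_q) (i q mu)^k exp(i q mu (x_j - x_l)), and exchanging j and
    l amounts to replacing the frequency q by -q, under which the range
    -N/2 <= q <= N/2 and the weights c_q are invariant, while (i q mu)^k
    acquires the sign (-1)^k. *)

Import Order.TTheory GRing.Theory Num.Theory.

Local Open Scope ring_scope.
Local Open Scope complex_scope.

Lemma antisym_quadratic_form (F : numFieldType) (n : nat) (K : 'M[F]_n)
    (x : 'cV[F]_n) : K^T = - K -> x^T *m K *m x = 0.
Proof.
move=> KT; set q := x^T *m K *m x.
have qT : q^T = - q.
  by rewrite /q !trmx_mul trmxK KT mulNmx mulmxN mulmxA.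
apply/matrixP=> i j; rewrite !ord1 [RHS]mxE.
have := congr1 (fun A : 'M[F]_1 => A 0 0) qT.
by rewrite !mxE => /eqP; rewrite -addr_eq0 -mulr2n mulrn_eq0 => /eqP.
Qed.

(** Pairing the step with V + W, through the transpose and without conjugation,
    kills the K term; the M term (V + W)^T M (V - W) reduces to the difference
    of the two quadratic forms, its cross terms cancelling by symmetry of M. *)
Lemma midpoint_conservation (F : numFieldType) (n : nat) (M K : 'M[F]_n)
    (V W : 'cV[F]_n) (c : F) : c != 0 -> M^T = M -> K^T = - K ->
  M *m (c *: (V - W)) + K *m (2^-1 *: (V + W)) = 0 ->
  V^T *m M *m V = W^T *m M *m W.
Proof.
move=> c0 MT KT step.
have := congr1 (mulmx (V + W)^T) step.
rewrite mulmx0 mulmxDr -!scalemxAr !mulmxA (@antisym_quadratic_form F n K (V + W) KT).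
rewrite scaler0 addr0 => /eqP; rewrite scaler_eq0 (negbTE c0)/= => /eqP.
have cross : V^T *m M *m W = W^T *m M *m V.
  have : (V^T *m M *m W)^T = W^T *m M *m V.
    by rewrite !trmx_mul trmxK MT mulmxA.
  by move=> <-; apply/matrixP => i j; rewrite !ord1 [RHS]mxE.
rewrite [(V + W)^T]linearD /= !mulmxDl !mulmxBr cross addrA subrK.
by move/eqP; rewrite subr_eq0 => /eqP.
Qed.

Section ComponentwiseDerivative.
Variable R : realType.
Implicit Types (f g : R -> R[i]) (w : R[i]).

(** The limits behind [cderiven] are junk values where a component is not
    differentiable, so termwise differentiation must carry differentiability
    along with the derivative. *)
Definition is_cderive f (x : R) w : Prop :=
  is_derive x 1 (fun t => complex.Re (f t)) (complex.Re w) /\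
  is_derive x 1 (fun t => complex.Im (f t)) (complex.Im w).

Lemma is_cderive_cst w (x : R) : is_cderive (fun=> w) x 0.
Proof. by split; apply: is_derive_cst. Qed.

Lemma is_cderiveD f g (x : R) w1 w2 : is_cderive f x w1 -> is_cderive g x w2 ->
  is_cderive (fun t => f t + g t) x (w1 + w2).
Proof.
move=> [fRe fIm] [gRe gIm]; split; rewrite raddfD/=.
- rewrite (_ : (fun t => _) =
    (fun t => complex.Re (f t)) + (fun t => complex.Re (g t))).
    exact: is_deriveD.
  by apply/funext => t; rewrite raddfD.
- rewrite (_ : (fun t => _) =
    (fun t => complex.Im (f t)) + (fun t => complex.Im (g t))).
    exact: is_deriveD.
  by apply/funext => t; rewrite raddfD.
Qed.

Lemma is_cderive_sum (I : Type) (r : seq I) (F : I -> R -> R[i]) (x : R)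
    (dF : I -> R[i]) : (forall i, is_cderive (F i) x (dF i)) ->
  is_cderive (fun t => \sum_(i <- r) F i t) x (\sum_(i <- r) dF i).
Proof.
move=> HF; elim: r => [|i r IH].
  rewrite big_nil (_ : (fun t => _) = fun=> 0); first exact: is_cderive_cst.
  by apply/funext => t; rewrite big_nil.
rewrite big_cons (_ : (fun t => _) =
  fun t => F i t + \sum_(j <- r) F j t); first exact: is_cderiveD.
by apply/funext => t; rewrite big_cons.
Qed.

(** The two components separately are the real identities behind
    (e^(iks))' = ik e^(iks). *)
Lemma is_cderive_expi w (k c x : R) :
  is_cderive (fun t => w * expi (k * (t - c))) x
    (w * (0 +i* k) * expi (k * (x - c))).
Proof.
have dlin : is_derive x 1 (fun t : R => k * (t - c)) k.
  rewrite (_ : (fun t => _) = k *: ((@id R) - cst c)) //.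
  by apply: is_derive_eq; rewrite subr0 [LHS]mulr1.
have dcos : is_derive x 1 (fun t => cos (k * (t - c))) (k * - sin (k * (x - c))).
  by apply: is_derive_eq (is_derive1_comp (is_derive_cos _) dlin) _; rewrite mulrC.
have dsin : is_derive x 1 (fun t => sin (k * (t - c))) (k * cos (k * (x - c))).
  by apply: is_derive_eq (is_derive1_comp (is_derive_sin _) dlin) _; rewrite mulrC.
case: w => u v; split => /=.
- rewrite (_ : (fun t => _) = u *: (fun t => cos (k * (t - c))) -
    v *: (fun t => sin (k * (t - c)))) //.
  by apply: is_derive_eq; rewrite /GRing.scale/=; ring.
- rewrite (_ : (fun t => _) = u *: (fun t => sin (k * (t - c))) +
    v *: (fun t => cos (k * (t - c)))) //.
  by apply: is_derive_eq; rewrite /GRing.scale/=; ring.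
Qed.

Lemma cderiven_trig_sum (n k : nat) (p : nat -> R[i]) (kappa : nat -> R)
    (c x : R) :
  cderiven k (fun t => \sum_(0 <= m < n) p m * expi (kappa m * (t - c))) x =
  \sum_(0 <= m < n) p m * (0 +i* kappa m) ^+ k * expi (kappa m * (x - c)).
Proof.
(* [q] is left free: at order l the coefficients are p_m (i kappa_m)^l. *)
have der q y := @is_cderive_sum _ (index_iota 0 n)
  (fun m t => q m * expi (kappa m * (t - c))) y _
  (fun m => is_cderive_expi (q m) (kappa m) c y).
pose S l t := \sum_(0 <= m < n)
  p m * (0 +i* kappa m) ^+ l * expi (kappa m * (t - c)).
have SS l y : is_cderive (S l) y (S l.+1 y).
  rewrite (_ : S l.+1 y = \sum_(0 <= m < n)
    p m * (0 +i* kappa m) ^+ l * (0 +i* kappa m) * expi (kappa m * (y - c))).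
    exact: der.
  by apply: eq_bigr => m _; rewrite exprSr mulrA.
have S0 : (fun t => \sum_(0 <= m < n) p m * expi (kappa m * (t - c))) = S 0%N.
  by apply/funext => t; apply: eq_bigr => m _; rewrite expr0 mulr1.
rewrite S0 -[RHS]/(S k x) /cderiven.
have -> : derive1n k (fun t => complex.Re (S 0%N t)) = fun t => complex.Re (S k t).
  elim: k => [|k IH] //; rewrite derive1nS IH; apply/funext => y.
  by rewrite derive1E; have [/@derive_val ->] := SS k y.
have -> : derive1n k (fun t => complex.Im (S 0%N t)) = fun t => complex.Im (S k t).
  elim: k => [|k IH] //; rewrite derive1nS IH; apply/funext => y.
  by rewrite derive1E; have [_ /@derive_val ->] := SS k y.
by case: (S k x).
Qed.

End ComponentwiseDerivative.

(** The sum over m = 0, ..., N runs over the frequencies m - N/2; as N is even,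
    the reversal m -> N - m is the change of sign of the frequency, and it
    preserves the weight, which depends on the absolute value only. *)
Lemma fourier_diffmx_tr (R : realType) (xL xR : R) (N k : nat) : ~~ odd N ->
  (fourier_diffmx xL xR N k)^T = (-1) ^+ k *: fourier_diffmx xL xR N k.
Proof.
move=> N_even; apply/matrixP => j l; rewrite !mxE.
pose freq m : int := m%:Z - (N./2)%:Z.
pose kappa m : R := (freq m)%:~R * wavenumber xL xR.
pose p m : R[i] := N%:R^-1 * (cweight R N (freq m))^-1.
have cardE (i : 'I_N) : cardinal_fun xL xR i = fun t => \sum_(0 <= m < N.+1)
    p m * expi (kappa m * (t - node xL xR i)).
  apply/funext => t; rewrite /cardinal_fun mulr_sumr.
  by apply: eq_bigr => m _; rewrite mulrA.
rewrite !cardE !cderiven_trig_sum mulr_sumr big_nat_rev.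
apply: eq_big_nat => m /andP[_ mN].
have freqN : freq (0 + N.+1 - m.+1)%N = - freq m.
  rewrite /freq add0n subSS -subzn -1?ltnS// opprB.
  rewrite -{1}(even_halfK N_even) -addnn PoszD; ring.
have kappaN : kappa (0 + N.+1 - m.+1)%N = - kappa m.
  by rewrite /kappa freqN mulrNz mulNr.
have pN : p (0 + N.+1 - m.+1)%N = p m.
  by rewrite /p freqN /cweight abszN.
rewrite kappaN pN mulNr -mulrN opprB.
rewrite (_ : 0 +i* - kappa m = -1 * (0 +i* kappa m)); last first.
  by rewrite mulN1r; apply/eqP; rewrite eq_complex/= oppr0 !eqxx.
by rewrite exprMn; ring.
Qed.

(** diag(U) D_1 + D_1 diag(U) is antisymmetric because transposition exchanges
    its two terms up to sign; this is what the splitting with weight gamma/3 of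
    the nonlinearity achieves. *)
Lemma Dop_antisym (R : realType) (xL xR a gamma : R) (N : nat)
    (U : 'cV[R[i]]_N) : ~~ odd N ->
  (Dop xL xR a gamma U)^T = - Dop xL xR a gamma U.
Proof.
move=> N_even; rewrite /Dop !(linearD, linearZ)/= !trmx_mul tr_diag_mx.
rewrite !fourier_diffmx_tr// expr1 !scaleN1r mulNmx mulmxN.
by congr (_ + _ *: _); exact: addrC.
Qed.

(** For real U the conjugate in the inner product disappears, and the squared
    norms are the inner products themselves: [sqrtC] squares back to its
    argument. *)
Lemma momentum_quadratic_form (R : realType) (xL xR sigma : R) (N : nat)
    (U : 'cV[R[i]]_N) : U \is a mxOver Num.real ->
  momentum_h xL xR sigma U = (mesh xL xR N)%:C *
    (U^T *m (1%:M - sigma%:C *: fourier_diffmx xL xR N 2) *m U) 0 0.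
Proof.
move=> /mxOverP U_real.
have innerE V : inner_h xL xR V U = (mesh xL xR N)%:C * (U^T *m V) 0 0.
  rewrite /inner_h mxE; congr (_ * _); apply: eq_bigr => j _.
  by rewrite (CrealP (U_real j 0)) mxE mulrC.
rewrite /momentum_h /norm_h /seminorm_h !sqrtCK !innerE.
rewrite mulrCA -mulrDr; congr (_ * _).
rewrite -mulmxA mulmxBl mul1mx mulmxBr [in RHS]mxE [X in _ = _ + X]mxE.
by rewrite mulNmx mulmxN -scalemxAl -scalemxAr !mxE mulrN.
Qed.

Theorem theorem3p3 (R : realType) (a sigma gamma : R)
    (a_gt0 : 0 < a) (sigma_gt0 : 0 < sigma) (gamma_gt0 : 0 < gamma)
    (xL xR : R) (L_gt0 : 0 < xR - xL)
    (N : nat) (N_gt0 : (0 < N)%N) (N_even : ~~ odd N)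
    (T : R) (T_gt0 : 0 < T) (Nt : nat) (Nt_gt0 : (0 < Nt)%N)
    (tau : R) (tauE : tau = T / Nt%:R)
    (U : nat -> 'cV[R[i]]_N)
    (U_real : forall n : nat, (n <= Nt)%N -> U n \is a mxOver Num.real)
    (scheme : forall n : nat, (1 <= n < Nt)%N ->
       (1%:M - sigma%:C *: fourier_diffmx xL xR N 2) *m delta_t tau U n
       + Dop xL xR a gamma (U n) *m hat_avg U n = 0)
    (first_level :
       (1%:M - sigma%:C *: fourier_diffmx xL xR N 2) *m delta_t_plus0 tau U
       + Dop xL xR a gamma (half_level U) *m half_level U = 0) :
  forall n : nat, (n <= Nt)%N ->
    momentum_h xL xR sigma (U n) = momentum_h xL xR sigma (U 0%N).
Proof.
set M := (X in X *m delta_t_plus0 _ _ + _) in first_level.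
have MT : M^T = M.
  rewrite /M linearB/= trmx1 linearZ/= fourier_diffmx_tr//.
  by rewrite sqrrN expr1n scale1r.
have DT (V : 'cV[R[i]]_N) : (Dop xL xR a gamma V)^T = - Dop xL xR a gamma V.
  exact: Dop_antisym.
have tau0 : tau != 0 by rewrite tauE mulf_neq0 ?invr_eq0 ?gt_eqF ?ltr0n.
have conserved m n : (m <= Nt)%N -> (n <= Nt)%N ->
    (U m)^T *m M *m U m = (U n)^T *m M *m U n ->
    momentum_h xL xR sigma (U m) = momentum_h xL xR sigma (U n).
  by move=> mN nN E; rewrite !momentum_quadratic_form ?U_real// -/M E.
(* The scheme relates n + 2 to n: two base cases, with level 1 reached by the
   starting step. *)
elim/ltn_ind => -[//|[_ _|n IH nN]].
  apply: conserved => //.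
  apply: (@midpoint_conservation _ _ M _ _ _ ((tau^-1)%:C) _ MT (DT _)
    first_level).
  by rewrite (inj_eq (@complexI R)) invr_eq0.
rewrite -(IH n)//; last by rewrite ltnW// ltnW.
apply: conserved => //; first by rewrite ltnW// ltnW.
apply: (@midpoint_conservation _ _ M _ _ _ (((2 * tau)^-1)%:C) _ MT (DT _)
  (scheme n.+1 nN)).
by rewrite (inj_eq (@complexI R)) invr_eq0 mulf_neq0// pnatr_eq0.
Qed.
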